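(* Let $(W,S)$ be a Coxeter system, let $I,J\subset S$ be finitary, and let $r$ be a core $(I,J)$-coset. Then one of the following two cases holds. (a) $r$ is an identity coset, meaning $I=J$ and $\underline r=\mathrm{id}$. Then $[I]$ is the unique reduced expression for $r$. (b) $r=p.q$ (a reduced composition) for core cosets $p$ and $q$, where for some $s\in S\setminus I$ (with $I\cup\{s\}$ finitary) and $t=w_{I\cup\{s\}}\,s\,w_{I\cup\{s\}}$, $p$ is the coset with reduced expression $[I+s-t]:=[I,\ I\cup\{s\},\ (I\cup\{s\})\setminus\{t\}]$. Moreover, $[I+s-t]$ is the unique reduced expression for $p$. (The possibility that $r=p$ and $q$ is an identity coset is allowed.)
   Context: Let $(W,S)$ be a Coxeter system with length function $\ell$. A subset $I\subset S$ is finitary if $W_I$ is finite; then $w_I$ is its longest element and $\ell(I)=\ell(w_I)$. For finitary $I,J$, an $(I,J)$-coset is an element $p\in W_I\backslash W/W_J$ (with $(I,J)$ part of the data), with unique Bruhat-maximal element $\overline p$ and unique Bruhat-minimal element $\underline p$. It is a core coset if $I=\underline pJ\underline p^{-1}$. Composition: let $*$ be the $0$-Hecke (star) product on $W$ (so $s*w=sw$ if $\ell(sw)>\ell(w)$, and $s*w=w$ otherwise). For an $(I,J)$-coset $p$ and a $(J,K)$-coset $q$, $p*q=W_I(\overline p*\overline q)W_K$ as an $(I,K)$-coset, and $\overline{p*q}=\overline p*\overline q$. The composition is reduced, written $p.q$, if $\overline p*\overline q=(\overline pw_J^{-1})\overline q$ with $\ell(\overline p*\overline q)=\ell(\overline p)-\ell(J)+\ell(\overline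 q)$. Expressions: a (singlestep) $(I,J)$-expression is a sequence $[I=L_0,L_1,\dots,L_d=J]$ of finitary subsets, in which each $L_{i}$ is obtained from $L_{i-1}$ by adding or removing exactly one element of $S$. Grouping consecutive additions and consecutive removals gives a sequence $[[I=I_0\subset K_1\supset I_1\subset\cdots\subset K_m\supset I_m=J]]$ (equalities allowed at the ends; for $d=0$ take $[[I\subset I\supset I]]$). The expression is a reduced expression for $p$ if $\overline p=w_{K_1}w_{I_1}^{-1}w_{K_2}\cdots w_{I_{m-1}}^{-1}w_{K_m}$ and $\ell(\overline p)=\ell(K_1)-\ell(I_1)+\ell(K_2)-\cdots-\ell(I_{m-1})+\ell(K_m)$. Uniqueness of reduced expressions is among singlestep expressions. *)

(* Defs.v *)
From mathcomp Require Import all_boot all_algebra fingroup.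
From mathcomp Require Import boolp classical_sets functions cardinality.

Set Implicit Arguments.
Unset Strict Implicit.
Unset Printing Implicit Defensive.

Local Open Scope classical_set_scope.
Local Open Scope group_scope.

(* A Coxeter system is a possibly infinite group W : groupType together with   *)
(* a possibly infinite set S : set W of simple reflections; subsets of S and   *)
(* double cosets are also terms of type set W.                                 *)

Definition word (W : groupType) (S : set W) (u : seq W) : Prop :=
  [set` u] `<=` S.

Definition wprod (W : groupType) (u : seq W) : W := \prod_(x <- u) x.

(* The congruence on words generated by the relations (st)^{m s t} = 1.        *)
(* The value m s t = 0 encodes m_{st} = oo: the relator is then the empty word.*)
Inductive coxeter_cong (W : groupType) (S : set W) (m : W -> W -> nat) :
    seq W -> seq W -> Prop :=
| coxeter_cong_refl u : coxeter_cong S m u u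
| coxeter_cong_sym u v : coxeter_cong S m u v -> coxeter_cong S m v u
| coxeter_cong_trans u v w :
    coxeter_cong S m u v -> coxeter_cong S m v w -> coxeter_cong S m u w
| coxeter_cong_relator a b s t : S s -> S t ->
    coxeter_cong S m (a ++ flatten (nseq (m s t) [:: s; t]) ++ b) (a ++ b).

(* W = < S | (st)^{m s t} = 1 > for some Coxeter matrix m. As m s s = 1, the   *)
(* generators are involutions, so W is presented by words without inverses.    *)
Definition coxeter_system (W : groupType) (S : set W) : Prop :=
  (forall w : W, exists2 u, word S u & wprod u = w) /\
  exists m : W -> W -> nat,
    [/\ forall s t, S s -> S t -> m s t = m t s,
        forall s t, S s -> S t -> (m s t = 1%N <-> s = t) &
        forall u v, word S u -> word S v ->
          (wprod u = wprod v <-> coxeter_cong S m u v)].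

Definition ell (W : groupType) (S : set W) (w : W) : nat :=
  xget 0%N [set n | (exists u, [/\ word S u, wprod u = w & size u = n]) /\
                    forall u, word S u -> wprod u = w -> (n <= size u)%N].

Definition is_subgroup (W : groupType) (H : set W) : Prop :=
  H 1 /\ forall x y, H x -> H y -> H (x * y^-1).

Definition parabolic (W : groupType) (I : set W) : set W :=
  smallest (@is_subgroup W) I.

Definition finitary (W : groupType) (S I : set W) : Prop :=
  I `<=` S /\ finite_set (parabolic I).

Definition longest (W : groupType) (S I : set W) : W :=
  xget 1 [set w | parabolic I w /\
                  forall v, parabolic I v -> (ell S v <= ell S w)%N].

Definition ellI (W : groupType) (S I : set W) : nat := ell S (longest S I).

Definition reflection (W : groupType) (S : set W) (t : W) : Prop :=
  exists w s, S s /\ t = w * s * w^-1.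

Inductive bruhat (W : groupType) (S : set W) : W -> W -> Prop :=
| bruhat_refl x : bruhat S x x
| bruhat_step x t y : reflection S t -> (ell S x < ell S (x * t)%g)%N ->
    bruhat S (x * t) y -> bruhat S x y.

Definition dcoset (W : groupType) (I J : set W) (x : W) : set W :=
  [set a * x * b | a in parabolic I & b in parabolic J].

Definition is_coset (W : groupType) (I J p : set W) : Prop :=
  exists x, p = dcoset I J x.

(* The default value 1 of xget is irrelevant: for finitary I and J, every      *)
(* (I,J)-coset has exactly one Bruhat-maximal and one Bruhat-minimal element.  *)
Definition cmax (W : groupType) (S p : set W) : W :=
  xget 1 [set x | p x /\ forall y, p y -> bruhat S x y -> y = x].

Definition cmin (W : groupType) (S p : set W) : W :=
  xget 1 [set x | p x /\ forall y, p y -> bruhat S y x -> y = x].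

Definition core_coset (W : groupType) (S I J p : set W) : Prop :=
  is_coset I J p /\ I = [set cmin S p * j * (cmin S p)^-1 | j in J].

Definition identity_coset (W : groupType) (S I J p : set W) : Prop :=
  I = J /\ cmin S p = 1.

Definition reduced_word (W : groupType) (S : set W) (w : W) : seq W :=
  xget [::] [set u | [/\ word S u, wprod u = w & size u = ell S w]].

Definition star_simple (W : groupType) (S : set W) (s w : W) : W :=
  if (ell S w < ell S (s * w)%g)%N then s * w else w.

(* (s_1 ... s_k) * y = s_1 * (s_2 * (... * (s_k * y))) for a reduced word      *)
(* s_1 ... s_k; the value does not depend on the choice of this word.          *)
Definition star (W : groupType) (S : set W) (x y : W) : W :=
  foldr (star_simple S) y (reduced_word S x).

Definition composition (W : groupType) (S I K p q : set W) : set W :=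
  dcoset I K (star S (cmax S p) (cmax S q)).

(* The composition of an (I,J)-coset p and a (J,K)-coset q is reduced.         *)
Definition reduced_composition (W : groupType) (S J p q : set W) : Prop :=
  let pq := star S (cmax S p) (cmax S q) in
  pq = (cmax S p * (longest S J)^-1) * cmax S q /\
  (ell S pq)%:Z%R =
    ((ell S (cmax S p))%:Z - (ellI S J)%:Z + (ell S (cmax S q))%:Z)%R.

Definition add_or_remove (W : groupType) (S A B : set W) : Prop :=
  exists s, S s /\ ((~ A s /\ B = A `|` [set s]) \/ (A s /\ B = A `\ s)).

Inductive expression (W : groupType) (S : set W) :
    set W -> set W -> seq (set W) -> Prop :=
| expression_nil I : finitary S I -> expression S I I [:: I]
| expression_cons I L1 J L : finitary S I -> add_or_remove S I L1 ->
    expression S L1 J L -> expression S I J (I :: L).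

(* grouping [:: L_0; ...; L_d] = [:: (K_1, I_1); ...; (K_m, I_m)], I_0 = L_0;  *)
(* group_up is inside an increasing run that has reached A, and group_down is  *)
(* inside a decreasing run that started at K and has reached A.                *)
Fixpoint group_up (W : groupType) (A : set W) (L : seq (set W)) :
    seq (set W * set W) :=
  if L is B :: L' then
    if `[< A `<=` B >] then group_up B L' else group_down A B L'
  else [:: (A, A)]
with group_down (W : groupType) (K A : set W) (L : seq (set W)) :
    seq (set W * set W) :=
  if L is B :: L' then
    if `[< A `<=` B >] then (K, A) :: group_up B L' else group_down K B L'
  else [:: (K, A)].

Definition grouping (W : groupType) (L : seq (set W)) : seq (set W * set W) :=
  if L is L0 :: L' then group_up L0 L' else [::].

(* w_{K_1} w_{I_1}^-1 w_{K_2} ... w_{I_{m-1}}^-1 w_{K_m}: I_m does not occur.  *)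
Fixpoint gprod (W : groupType) (S : set W) (M : seq (set W * set W)) : W :=
  match M with
  | [::] => 1
  | [:: (K, _)] => longest S K
  | (K, K') :: M' => longest S K * (longest S K')^-1 * gprod S M'
  end.

Fixpoint glen (W : groupType) (S : set W) (M : seq (set W * set W)) : int :=
  match M with
  | [::] => 0%R
  | [:: (K, _)] => (ellI S K)%:Z%R
  | (K, K') :: M' => ((ellI S K)%:Z - (ellI S K')%:Z + glen S M')%R
  end.

Definition reduced_expression (W : groupType) (S I J p : set W)
    (L : seq (set W)) : Prop :=
  [/\ expression S I J L, cmax S p = gprod S (grouping L) &
      (ell S (cmax S p))%:Z%R = glen S (grouping L)].

Definition unique_reduced_expression (W : groupType) (S I J p : set W)
    (L : seq (set W)) : Prop :=
  reduced_expression S I J p L /\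
  forall L', reduced_expression S I J p L' -> L' = L.

(* Main.v *)
(* The exchange condition comes from the fact that the parity of the number of *)
(* times a reflection occurs in the inversion list of a word is invariant       *)
(* under the Coxeter relations.                                                 *)
(*   Let x be the minimal element of the core (I,J)-coset r, so that            *)
(* r = W_I x = x W_J. If x <> 1, a left descent s of x is not in I, and         *)
(* K = I + s consists of left descents of the maximal element w_I x = x w_J.    *)
(* Hence K is finitary and w_I x = w_K z with z minimal in W_K z. With          *)
(* y = w_I w_K one gets x = y z; y is the minimal element of p, which is        *)
(* core since conjugation by w_K permutes K, and z is that of q.                *)
(*   For uniqueness: a reduced expression of a core coset cannot start with     *)
(* a removal, its first run of additions stays inside the left descents of      *)
(* the maximal element, and any addition after a removal from K makes the       *)
(* length exceed l(K).                                                          *)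

Require Import Defs.
From mathcomp Require Import all_boot all_algebra fingroup.
From mathcomp Require Import boolp classical_sets functions cardinality.
From mathcomp Require Import zify.

Local Open Scope classical_set_scope.
Local Open Scope group_scope.

(** Everything rests on [exchange], mostly through [exchange_mul], which makes local conditions
    global. If every generator in I lengthens x, lengths add on W_I x ([ell_lmin_mul]); if every
    generator in K shortens x, each element of W_K is a prefix of x ([ldesc_mul]), so W_K is finite
    for finite K ([ldesc_finitary]). In a core coset W_J is absorbed into W_I ([core_mem]), so the
    extremal elements are x and w_I x. A left descent s of x then gives K = I + s by
    [core_ldesc_add]. Stripping w_K from w_I x gives the two factors ([core_longest_quo],
    [core_quo]), and [star_longest] computes their composition. Uniqueness is a matter of descents:
    the first set of a reduced expression consists of left descents of its value, the last of right
    descents ([reduced_desc]). This confines additions ([core1_unique], [core_add_unique]) and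
    excludes an initial removal ([core_no_remove]). *)

Section Coxeter.

Set Implicit Arguments.
Unset Strict Implicit.

Variables (W : groupType) (S : set W).
Hypothesis cox : coxeter_system S.

Notation l := (ell S).

Implicit Types (u v : seq W) (w x y z s t : W) (I J K : set W).

(* Inference finds several convertible but distinct terms for the instance of  *)
(* [*]; [lia] and [rewrite] need a single one.                                 *)
Local Notation "x * y" := (@monoid.mul W x y) : group_scope.
Let mulgA x y z : x * (y * z) = x * y * z. Proof. exact: mulgA. Qed.
Let invMg x y : (x * y)^-1 = y^-1 * x^-1. Proof. exact: invMg. Qed.
Let invgK x : x^-1^-1 = x. Proof. exact: invgK. Qed.
Let mulKg x y : x^-1 * (x * y) = y. Proof. exact: mulKg. Qed.
Let mulVKg x y : x * (x^-1 * y) = y. Proof. exact: mulVKg. Qed.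
Let mulgK x y : y * x * x^-1 = y. Proof. exact: mulgK. Qed.
Let mulgKV x y : y * x^-1 * x = y. Proof. exact: mulgKV. Qed.

(** * Words and length *)

Lemma word_nil I : word I [::].
Proof. by move=> x. Qed.

Lemma word_cons I s u : word I (s :: u) <-> I s /\ word I u.
Proof.
split=> [h|[Is h] x]; last by rewrite /= inE => /orP[/eqP->//|/h].
by split=> [|x /= xu]; apply: h; rewrite /= inE ?eqxx// xu orbT.
Qed.

Lemma word_cat I u v : word I (u ++ v) <-> word I u /\ word I v.
Proof.
elim: u => [|s u IHu] /=; first by split=> [|[]//]; split=> //; exact: word_nil.
rewrite !word_cons IHu; tauto.
Qed.

Lemma word_rev I u : word I u -> word I (rev u).
Proof. by move=> h x /=; rewrite mem_rev => /h. Qed.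

Lemma word_sub I J u : I `<=` J -> word I u -> word J u.
Proof. by move=> IJ h x /h/IJ. Qed.

Lemma wprod_nil : wprod [::] = 1 :> W.
Proof. by rewrite /wprod big_nil. Qed.

Lemma wprod_cons s u : wprod (s :: u) = s * wprod u.
Proof. by rewrite /wprod big_cons. Qed.

Lemma wprod_cat u v : wprod (u ++ v) = wprod u * wprod v.
Proof. by rewrite /wprod big_cat. Qed.

Lemma wprod1 s : wprod [:: s] = s.
Proof. by rewrite wprod_cons wprod_nil mulg1. Qed.

Lemma gen_sq s : S s -> s * s = 1.
Proof.
move=> Ss; have [_ [m [_ m1 mP]]] := cox.
have mss : m s s = 1%N by apply/m1.
have : wprod [:: s; s] = wprod [::].
  apply/mP; [by rewrite !word_cons; repeat split => //; exact: word_nil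
            | exact: word_nil |].
  by have := @coxeter_cong_relator _ S m [::] [::] s s Ss Ss; rewrite mss.
by rewrite wprod_cons wprod1 wprod_nil.
Qed.

Lemma genV s : S s -> s^-1 = s.
Proof. by move=> /gen_sq/mulg1_eq. Qed.

Lemma mulKgen s x : S s -> s * (s * x) = x.
Proof. by move=> Ss; rewrite mulgA gen_sq ?mul1g. Qed.

Lemma wprod_rev u : word S u -> wprod (rev u) = (wprod u)^-1.
Proof.
elim: u => [|s u IHu] /=; first by rewrite wprod_nil invg1.
move=> /word_cons[Ss Su]; rewrite rev_cons -cats1 wprod_cat wprod1.
by rewrite wprod_cons invMg IHu// (genV Ss).
Qed.

Lemma ell_spec w :
  (exists u, [/\ word S u, wprod u = w & size u = l w]) /\
  forall u, word S u -> wprod u = w -> (l w <= size u)%N.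
Proof.
rewrite /ell; set P := (X in xget _ X); apply: (@xgetPex _ 0%N P).
have [/(_ w)[u Su uw] _] := cox.
have ex : exists n, `[< exists u, [/\ word S u, wprod u = w & size u = n] >].
  by exists (size u); apply/asboolP; exists u.
exists (ex_minn ex); case: ex_minnP => n /asboolP nP nmin; split=> // v Sv vw.
by apply: nmin; apply/asboolP; exists v.
Qed.

Lemma reduced_ex w : exists u, [/\ word S u, wprod u = w & size u = l w].
Proof. by case: (ell_spec w). Qed.

Lemma ell_wprod u : word S u -> (l (wprod u) <= size u)%N.
Proof. by move=> Su; case: (ell_spec (wprod u)) => _; apply. Qed.

Lemma ell1 : l 1 = 0%N.
Proof.
by apply/eqP; rewrite -leqn0 -wprod_nil ell_wprod//; exact: word_nil.
Qed.

Lemma ell0 w : l w = 0%N -> w = 1.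
Proof.
have [[|s u] [_ <- <-]] := reduced_ex w => // _.
exact: wprod_nil.
Qed.

Lemma ellM x y : (l (x * y) <= l x + l y)%N.
Proof.
have [u [Su <- <-]] := reduced_ex x; have [v [Sv <- <-]] := reduced_ex y.
by rewrite -wprod_cat -size_cat ell_wprod// word_cat.
Qed.

Lemma ell_gen s : S s -> (l s <= 1)%N.
Proof.
move=> Ss; rewrite -{1}(wprod1 s) (@ell_wprod [:: s])// word_cons.
by split=> //; exact: word_nil.
Qed.

Lemma ellV w : l w^-1 = l w.
Proof.
have le x : (l x^-1 <= l x)%N.
  have [u [Su <- <-]] := reduced_ex x.
  by rewrite -wprod_rev// -(size_rev u) ell_wprod//; exact: word_rev.
by apply/eqP; rewrite eqn_leq le -{1}(invgK w) le.
Qed.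

(** * The exchange condition *)

(* The reflections [s_1 ... s_(i-1) s_i s_(i-1) ... s_1], in order of [i].     *)
Fixpoint refls u : seq W :=
  if u is s :: u' then s :: [seq s * t * s^-1 | t <- refls u'] else [::].

Lemma refls_cat u v :
  refls (u ++ v) =
  refls u ++ [seq wprod u * t * (wprod u)^-1 | t <- refls v].
Proof.
elim: u => [|s u IHu] /=.
  rewrite -[LHS]map_id; apply: eq_map => t.
  by rewrite wprod_nil invg1 mul1g mulg1.
rewrite IHu map_cat -map_comp; congr (_ :: _ ++ _); apply: eq_map => t /=.
by rewrite wprod_cons invMg !mulgA.
Qed.

(** These are the reflections of a dihedral group: once (st)^n = 1, the list runs twice through the
    same values. *)
Lemma refls_relator s t n : S s -> S t ->
  refls (flatten (nseq n [:: s; t])) =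
  [seq (s * t) ^+ j * s | j <- iota 0 (n + n)].
Proof.
move=> Ss St; elim: n => [//|n IHn].
rewrite addnS addSn /= IHn -!map_comp mul1g expg1 genV//; congr [:: _, _ & _].
rewrite (iotaDl 2 0) -map_comp; apply: eq_map => j /=.
rewrite !genV// !expgS -!mulgA; congr (_ * (_ * _)).
have := congr1 (fun x => x * s) (expgSr (s * t) j).
by rewrite expgS -!mulgA.
Qed.

Lemma count_conj t x (r : seq W) :
  count_mem t [seq x * y * x^-1 | y <- r] = count_mem (x^-1 * t * x) r.
Proof.
rewrite count_map; apply: eq_count => y /=.
apply/eqP/eqP => [<-|->];
  by rewrite !mulgA ?mulVg ?mul1g ?mulgV ?mul1g ?mulgKV ?mulgK.
Qed.

(** A relator has product 1, so inserting it keeps the reflections of the other letters and adds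
    conjugates of a list in which every value occurs an even number of times. *)
Lemma parity_cong u v : word S u -> word S v -> wprod u = wprod v ->
  forall t, odd (count_mem t (refls u)) = odd (count_mem t (refls v)).
Proof.
have [_ [m [_ _ mP]]] := cox.
move=> Su Sv /(mP _ _ Su Sv) {Su Sv} uv.
suff : wprod u = wprod v /\
  forall t, odd (count_mem t (refls u)) = odd (count_mem t (refls v)) by case.
elim: uv => {u v} [u|u v _ [-> IH]|u v w _ [-> IH] _ [-> IH']|a b s t Ss St] //.
- by split=> // t; rewrite IH.
- by split=> // t; rewrite IH IH'.
set r := flatten _.
have Sr : word S r.
  rewrite /r; elim: (m s t) => [|n IHn] /=; first exact: word_nil.
  by rewrite !word_cons.
have r1 : wprod r = 1.
  rewrite -wprod_nil; apply/mP => //.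
  by have := @coxeter_cong_relator _ S m [::] [::] s t Ss St; rewrite !cats0.
have st1 : (s * t) ^+ m s t = 1.
  rewrite -r1 /r; elim: (m s t) => [|n IHn] /=; first by rewrite wprod_nil.
  by rewrite !wprod_cons -IHn expgS mulgA.
split=> [|t']; first by rewrite !wprod_cat r1 mul1g.
rewrite !refls_cat r1 !count_cat !oddD !count_conj.
have -> : [seq 1 * y * 1^-1 | y <- refls b] = refls b.
  rewrite -[RHS]map_id; apply: eq_map => y; by rewrite invg1 mul1g mulg1.
move: (_ * wprod a) => x; congr (_ (+) _); rewrite count_cat oddD.
suff -> : odd (count_mem x (refls r)) = false by rewrite addFb.
rewrite /r refls_relator// iotaD map_cat count_cat add0n oddD.
(* The second half of the indices is the first shifted by [m s t], which does not change the powers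
   of st. *)
rewrite (_ : iota (m s t) (m s t) = map (addn (m s t)) (iota 0 (m s t))).
  2: by rewrite -iotaDl addn0.
rewrite -map_comp.
rewrite (@eq_map _ _ _ (fun j => (s * t) ^+ j * s)) ?addbb// => j /=.
by rewrite expgnDr st1 mul1g.
Qed.

Lemma mem_conj x t (r : seq W) : t \in [seq x * y * x^-1 | y <- r] ->
  exists2 t' : W, t' \in r & t = x * t' * x^-1.
Proof. by move=> /mapP. Qed.

(** Left multiplication by the i-th reflection of a word deletes its i-th letter. *)
Lemma refls_del u t : word S u -> t \in refls u ->
  exists a b s, u = a ++ s :: b /\ t * wprod u = wprod (a ++ b).
Proof.
elim: u t => [//|s u IHu] t /word_cons[Ss Su] /=; rewrite inE.
case/orP => [/eqP->|/mapP[t' /IHu[//|a [b [x [-> e]]]] ->]].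
  by exists [::], u, s; rewrite wprod_cons mulKgen.
exists (s :: a), b, x; split=> //.
by rewrite cat_cons !wprod_cons -e !mulgA mulgKV.
Qed.

Lemma ell_refls u t : word S u -> t \in refls u ->
  (l (t * wprod u) < size u)%N.
Proof.
move=> Su /refls_del[//|a [b [s [ueq ->]]]].
move: Su; rewrite ueq => /word_cat[Sa /word_cons[_ Sb]].
rewrite (leq_ltn_trans (ell_wprod _)) ?word_cat//.
by rewrite !size_cat /= addnS.
Qed.

(* Otherwise [s] occurs oddly often among the reflections of [s :: u], hence   *)
(* among those of a reduced word of [s * wprod u], and deleting it shortens.   *)
Lemma exchange s u : S s -> word S u -> (l (s * wprod u) <= l (wprod u))%N ->
  s \in refls u.
Proof.
move=> Ss Su le; apply: contraT => nsu.
have [v [Sv vE sv]] := reduced_ex (s * wprod u).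
have Ssu : word S (s :: u) by rewrite word_cons.
have := @parity_cong v (s :: u) Sv Ssu; rewrite vE wprod_cons => /(_ erefl s).
rewrite /= eqxx count_conj mulVg mul1g (count_memPn nsu) /= => osv.
have /(ell_refls Sv) : s \in refls v.
  by apply: contraT => /count_memPn sv0; rewrite sv0 in osv.
by rewrite vE mulKgen// sv ltnNge le.
Qed.

(** If s does not lengthen w, [exchange] makes s a reflection of a reduced word of w, and then s
    shortens w strictly. *)
Lemma ell_gen_mul s w : S s -> l (s * w) = (l w).+1 \/ l w = (l (s * w)).+1.
Proof.
move=> Ss; have [u [Su <- su]] := reduced_ex w.
have := ellM s (wprod u); have := ellM s (s * wprod u); rewrite mulKgen//.
have := ell_gen Ss.
case: (leqP (l (s * wprod u)) (l (wprod u))) => [le|]; last lia.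
have /(ell_refls Su) := exchange Ss Su le; lia.
Qed.

Lemma gen_neq1 s : S s -> s <> 1.
Proof.
move=> /(ell_gen_mul 1)[]; rewrite ?mulg1 ?ell1 => e s1;
  by rewrite s1 ?mulg1 ell1 in e.
Qed.

Lemma ell_gen1 s : S s -> l s = 1%N.
Proof.
move=> Ss; have := ell_gen Ss; have := gen_neq1 Ss.
by case: (l s) (@ell0 s) => [|[]] // -> //.
Qed.

(** The letter deleted by the exchange cannot belong to x, which s lengthens; so it belongs to y. *)
Lemma exchange_mul s x y : S s -> l (x * y) = (l x + l y)%N ->
  (l x < l (s * x))%N -> (l (s * (x * y)) <= l (x * y))%N ->
  exists2 y', s * (x * y) = x * y' & l y = (l y').+1.
Proof.
move=> Ss; have [u [Su <- su]] := reduced_ex x.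
have [v [Sv <- sv]] := reduced_ex y; rewrite -wprod_cat => lxy lsx le.
have Suv : word S (u ++ v) by rewrite word_cat.
have := exchange Ss Suv le; rewrite refls_cat mem_cat => /orP[su'|].
  by have := ell_refls Su su'; lia.
move=> /mem_conj[t tv sE]; exists (t * wprod v).
  by rewrite sE wprod_cat !mulgA mulgKV.
have := ell_refls Sv tv; have := ell_gen_mul (wprod (u ++ v)) Ss.
have : s * wprod (u ++ v) = wprod u * (t * wprod v).
  by rewrite sE wprod_cat !mulgA mulgKV.
move: le => /[swap] ->; have := ellM (wprod u) (t * wprod v); lia.
Qed.

(** * Parabolic subgroups *)

Lemma parabolic_subgroup I : is_subgroup (parabolic I).
Proof.
split=> [A [[]]//|x y Ix Iy A AP]; have [[A1 AM] _] := AP.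
by apply: AM; [exact: Ix|exact: Iy].
Qed.

Lemma parabolic1 I : parabolic I 1.
Proof. by case: (parabolic_subgroup I). Qed.

Lemma parabolicV I x : parabolic I x -> parabolic I x^-1.
Proof.
by move=> Ix; rewrite -[x^-1]mul1g; case: (parabolic_subgroup I) => ? ; apply.
Qed.

Lemma parabolicM I x y : parabolic I x -> parabolic I y -> parabolic I (x * y).
Proof.
move=> Ix /parabolicV Iy; rewrite -[y]invgK.
by case: (parabolic_subgroup I) => ?; apply.
Qed.

Lemma parabolic_gen I s : I s -> parabolic I s.
Proof. exact: sub_gen_smallest. Qed.

Lemma parabolic_sub I J : I `<=` J -> parabolic I `<=` parabolic J.
Proof.
by move=> IJ; apply: sub_smallest2r => //; exact: parabolic_subgroup.
Qed.

Lemma parabolic_word I u : word I u -> parabolic I (wprod u).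
Proof.
elim: u => [_|s u IHu /word_cons[Is Iu]].
  by rewrite wprod_nil; exact: parabolic1.
by rewrite wprod_cons; apply: parabolicM; [exact: parabolic_gen|exact: IHu].
Qed.

Lemma parabolicE I x : I `<=` S ->
  parabolic I x -> exists2 u, word I u & wprod u = x.
Proof.
move=> IS; pose A := [set x | exists2 u, word I u & wprod u = x].
apply: (@smallest_sub _ _ _ A).
  split=> [|_ _ [u Iu <-] [v Iv <-]].
    by exists [::]; [exact: word_nil|exact: wprod_nil].
  exists (u ++ rev v); first by rewrite word_cat; split=> //; exact: word_rev.
  by rewrite wprod_cat wprod_rev//; exact: word_sub Iv.
move=> s Is; exists [:: s]; last exact: wprod1.
by rewrite word_cons; split=> //; exact: word_nil.
Qed.

(** The exchange shortens a word by deleting letters, so a word in I stays in I until it is reduced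
    with respect to S. *)
Lemma parabolic_reduced I x : I `<=` S -> parabolic I x ->
  exists u, [/\ word I u, wprod u = x & size u = l x].
Proof.
move=> IS Ix; have [u0 Iu0 u0x] := parabolicE IS Ix.
elim: {u0}(size u0) {-2}u0 (leqnn (size u0)) x {Ix} Iu0 u0x => [|n IHn] u.
  rewrite leqn0 => /nilP-> x _ <-; exists [::]; split=> //.
  by rewrite wprod_nil ell1.
case: u => [|s u] su x.
  by move=> _ <-; exists [::]; split=> //; rewrite wprod_nil ell1.
move=> /word_cons[Is Iu]; rewrite wprod_cons => <- {x}.
have [v [Iv vu]] := IHn u su (wprod u) Iu erefl; rewrite -vu => sv.
have Sv := word_sub IS Iv; have Ss := IS _ Is.
have [e|e] := ell_gen_mul (wprod v) Ss.
  exists (s :: v); split; first by rewrite word_cons.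
    by rewrite wprod_cons.
  by rewrite /= e sv.
have /(refls_del Sv)[a [b [x [vE ->]]]] : s \in refls v.
  by apply: exchange => //; rewrite e.
have := ell_wprod (word_sub IS Iu); rewrite -vu -sv vE size_cat /= addnS => le.
move: Iv; rewrite vE => /word_cat[Ia /word_cons[_ Ib]].
apply: (IHn (a ++ b)) => //; last by rewrite word_cat.
by rewrite size_cat; move: su => /=; lia.
Qed.

Lemma parabolic_ind I (P : W -> Prop) : I `<=` S -> P 1 ->
  (forall s x, I s -> parabolic I x -> l (s * x) = (l x).+1 -> P x ->
    P (s * x)) ->
  forall x, parabolic I x -> P x.
Proof.
move=> IS P1 PM x /(parabolic_reduced IS)[u [Iu <-]].
elim: u Iu => [|s u IHu]; first by rewrite wprod_nil.
move=> /word_cons[Is Iu]; rewrite wprod_cons /= => su.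
have := ell_wprod (word_sub IS Iu); have := ell_gen_mul (wprod u) (IS _ Is).
move=> h1 h2; have e : size u = l (wprod u) by lia.
apply: PM => //; [exact: parabolic_word|lia|exact: IHu].
Qed.

Lemma parabolic_lt I x : I `<=` S -> parabolic I x -> x <> 1 ->
  exists2 s, I s & l x = (l (s * x)).+1.
Proof.
move=> IS; move: x; apply: (parabolic_ind IS) => // s y Is _ e _ _.
exists s => //.
by rewrite mulKgen//; exact: IS.
Qed.

Lemma parabolic_gen1 I x : I `<=` S -> parabolic I x -> l x = 1%N -> I x.
Proof.
move=> IS Ix x1; have [u [Iu uE]] := parabolic_reduced IS Ix; rewrite x1 -uE.
case: u Iu {uE} => [//|s [|//]] /word_cons[Is _] _.
by rewrite wprod1.
Qed.

(** By exchange, s x is again a product of letters of I, so s lies in W_I and has length 1. *)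
Lemma parabolic_desc I s x : I `<=` S -> S s -> parabolic I x ->
  (l (s * x) <= l x)%N -> I s.
Proof.
move=> IS Ss Ix le; apply: parabolic_gen1 => //; last exact: ell_gen1.
have [u Iu uE] := parabolicE IS Ix; rewrite -uE in le Ix.
have Su := word_sub IS Iu.
have /(refls_del Su)[a [b [t [ueq e]]]] := exchange Ss Su le.
rewrite -(mulgK (wprod u) s); apply: parabolicM; last exact: parabolicV.
rewrite e; apply: parabolic_word; move: Iu.
by rewrite ueq !word_cat word_cons => -[? []].
Qed.

(** * Minimal representatives and descents *)

Definition lmin I x := forall s, I s -> (l x < l (s * x))%N.
Definition ldesc I x := forall s, I s -> (l (s * x) < l x)%N.
Definition rdesc J x := forall s, J s -> (l (x * s) < l x)%N.

(** If s lengthens a but not a x, [exchange_mul] replaces x by a shorter element of W_I x. *)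
Lemma ell_shortest_mul I x a : I `<=` S ->
  (forall b, parabolic I b -> (l x <= l (b * x))%N) ->
  parabolic I a -> l (a * x) = (l a + l x)%N.
Proof.
move=> IS xmin; move: a; apply: (parabolic_ind IS) => [|s a Is Ia sa IHa].
  by rewrite mul1g ell1.
rewrite -mulgA.
have [|le] := ltnP (l (a * x)) (l (s * (a * x))).
  by have := ell_gen_mul (a * x) (IS _ Is); lia.
have [|y e] := @exchange_mul s a x (IS _ Is) IHa _ le; first by rewrite sa.
have yE : y = (a^-1 * s * a) * x by rewrite -!mulgA e mulKg.
have Py : parabolic I (a^-1 * s * a).
  apply: parabolicM => //; apply: parabolicM; last exact: parabolic_gen.
  exact: parabolicV.
by have := xmin _ Py; rewrite -yE; lia.
Qed.

Lemma shortest_ex I x : exists2 a, parabolic I a &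
  forall b, parabolic I b -> (l (a * x) <= l (b * x))%N.
Proof.
have ex : exists n, `[< exists2 a, parabolic I a & l (a * x) = n >].
  by exists (l (1 * x)); apply/asboolP; exists 1 => //; exact: parabolic1.
case: (ex_minnP ex) => n /asboolP[a Ia aE] nmin.
by exists a => // b Ib; rewrite aE; apply: nmin; apply/asboolP; exists b.
Qed.

(** Let c x be shortest in W_I x. If c were not 1, a left descent of c^-1 would be one of x = c^-1
    (c x), as lengths add there. *)
Lemma ell_lmin_mul I x a : I `<=` S -> lmin I x ->
  parabolic I a -> l (a * x) = (l a + l x)%N.
Proof.
move=> IS xmin; suff h b : parabolic I b -> (l x <= l (b * x))%N.
  exact: ell_shortest_mul.
have [c Ic cmin] := shortest_ex I x.
have [c1|/eqP c1] := eqVneq c 1.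
  by rewrite c1 mul1g in cmin; exact: cmin.
have ymul d : parabolic I d -> l (d * (c * x)) = (l d + l (c * x))%N.
  apply: ell_shortest_mul => // e Ie; rewrite mulgA; apply: cmin.
  exact: parabolicM.
have Vc := parabolicV Ic.
have [|s Is e] := parabolic_lt IS Vc.
  by move/eqP; rewrite invg_eq1 => /eqP.
have := xmin s Is.
have -> : s * x = (s * c^-1) * (c * x) by rewrite mulgA mulgKV.
have {1}-> : x = c^-1 * (c * x) by rewrite mulKg.
rewrite !ymul//; first lia.
by apply: parabolicM => //; exact: parabolic_gen.
Qed.

(** Induction along a reduced word of v: if a is a prefix of x and s lengthens a, then s, a descent
    of x, takes its letter from a^-1 x. *)
Lemma ldesc_mul K x (v : W) : K `<=` S -> ldesc K x -> parabolic K v ->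
  (l (v^-1 * x) + l v)%N = l x.
Proof.
move=> KS xK; move: v; apply: (parabolic_ind KS) => [|s a Ks Ka sa IHa].
  by rewrite invg1 mul1g ell1 addn0.
have := @exchange_mul s a (a^-1 * x) (KS _ Ks); rewrite mulVKg addnC.
case=> [|||y e ey]; [by rewrite -IHa addnC|by rewrite sa|exact/ltnW/xK|].
rewrite invMg (genV (KS _ Ks)) -mulgA e mulKg.
by rewrite -IHa ey; lia.
Qed.

(** By [ldesc_mul] no element of W_K is longer than x, and a finite K has finitely many words of
    bounded length. *)
Lemma ldesc_finitary K x : finite_set K -> K `<=` S -> ldesc K x ->
  finitary S K.
Proof.
move=> finK KS xK; split=> //.
suff h n : finite_set [set a | parabolic K a /\ (l a <= n)%N].
  apply: sub_finite_set (h (l x)) => a Ka; split=> //.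
  by have := ldesc_mul KS xK Ka; lia.
elim: n => [|n IHn].
  apply: (@sub_finite_set _ _ [set 1]) (finite_set1 _) => a [_].
  by rewrite leqn0 => /eqP/ell0.
pose B := [set s * a | s in K & a in [set a | parabolic K a /\ (l a <= n)%N]].
apply: (@sub_finite_set _ _ ([set 1] `|` B)).
  move=> a [Ka an]; have [->|/eqP a1] := eqVneq a 1; [by left|right].
  have [s Ks e] := parabolic_lt KS Ka a1; exists s => //; exists (s * a).
    by split; [apply: parabolicM => //; exact: parabolic_gen|lia].
  by rewrite mulKgen//; exact: KS.
by rewrite finite_setU; split; [exact: finite_set1|exact: finite_image2].
Qed.

(** * Longest elements *)

Lemma longestP K : finitary S K -> parabolic K (longest S K) /\
  forall v : W, parabolic K v -> (l v <= l (longest S K))%N.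
Proof.
move=> [KS /finite_seqP[r rE]]; rewrite /longest.
set P := (X in xget _ X); apply: (@xgetPex _ _ P).
have ex : exists n, `[< exists2 a, parabolic K a & l a = n >].
  by exists (l 1); apply/asboolP; exists 1 => //; exact: parabolic1.
have ub n : `[< exists2 a, parabolic K a & l a = n >] ->
    (n <= \max_(a <- r) l a)%N.
  move=> /asboolP[a Ka <-]; apply: leq_bigmax_seq => //.
  by move: Ka; rewrite rE.
case: (ex_maxnP ex ub) => n /asboolP[a Ka <-] nmax; exists a; split=> // b Kb.
by apply: nmax; apply/asboolP; exists b.
Qed.

Section Longest.
Variable K : set W.
Hypothesis finK : finitary S K.
Notation w := (longest S K).

Let KS : K `<=` S. Proof. by case: finK. Qed.

Lemma longest_parabolic : parabolic K w.
Proof. by case: (longestP finK). Qed.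

Lemma longest_max (v : W) : parabolic K v -> (l v <= l w)%N.
Proof. by case: (longestP finK) => _; apply. Qed.

Lemma longest_ldesc : ldesc K w.
Proof.
move=> s Ks; have := ell_gen_mul w (KS Ks).
have : parabolic K (s * w).
  by apply: parabolicM; [exact: parabolic_gen|exact: longest_parabolic].
by move=> /longest_max; lia.
Qed.

Lemma longest_mul (v : W) : parabolic K v -> (l (v^-1 * w) + l v)%N = l w.
Proof. exact: ldesc_mul KS longest_ldesc. Qed.

Lemma longest_eq (v : W) : parabolic K v -> (l w <= l v)%N -> v = w.
Proof.
move=> Kv le; have := longest_mul Kv => e.
have /ell0 h : l (v^-1 * w) = 0%N by lia.
by rewrite -(mulKVg v w) h mulg1.
Qed.

Lemma ldesc_longest (v : W) : parabolic K v -> ldesc K v -> v = w.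
Proof.
move=> Kv vK; apply: longest_eq => //.
by have := ldesc_mul KS vK longest_parabolic; lia.
Qed.

Lemma longestV : w^-1 = w.
Proof.
apply: longest_eq; last by rewrite ellV.
by apply: parabolicV; exact: longest_parabolic.
Qed.

Lemma longest_sq : w * w = 1.
Proof. by rewrite -{1}longestV mulVg. Qed.

Lemma longestK x : w * (w * x) = x.
Proof. by rewrite mulgA longest_sq mul1g. Qed.

Lemma longest_desc s : S s -> (l (s * w) < l w)%N -> K s.
Proof.
by move=> Ss /ltnW; apply: parabolic_desc => //; exact: longest_parabolic.
Qed.

(** Both passing from v to v^-1 w and repeating this step complement the length with respect to l
    w. *)
Lemma ell_longest_conj (v : W) : parabolic K v -> l (w * v * w) = l v.
Proof.
move=> Kv; have := longest_mul Kv.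
have /longest_mul : parabolic K (v^-1 * w).
  by apply: parabolicM; [exact: parabolicV|exact: longest_parabolic].
by rewrite invMg invgK longestV; lia.
Qed.

Lemma parabolic_longest_conj (v : W) : parabolic K v -> parabolic K (w * v * w).
Proof.
have Kw := longest_parabolic.
by move=> Kv; apply: parabolicM => //; exact: parabolicM.
Qed.

Lemma longest_conj s : K s -> K (w * s * w).
Proof.
move=> Ks; have Ps := parabolic_gen Ks.
apply: parabolic_gen1 => //; first exact: parabolic_longest_conj.
by rewrite ell_longest_conj// ell_gen1//; exact: KS.
Qed.

End Longest.

Lemma finitary_sub I K : I `<=` K -> finitary S K -> finitary S I.
Proof.
move=> IK [KS finK]; split; first exact: subset_trans KS.
exact: sub_finite_set (parabolic_sub IK) finK.
Qed.

Lemma ellI_le I K : I `<=` K -> finitary S K -> (ellI S I <= ellI S K)%N.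
Proof.
move=> IK finK; apply: (longest_max finK); apply: (parabolic_sub IK).
by apply: longest_parabolic; exact: finitary_sub finK.
Qed.

(** Equal lengths would force w_I = w_K, whose left descents are both I and K. *)
Lemma ellI_lt I K : I `<=` K -> finitary S K -> I <> K ->
  (ellI S I < ellI S K)%N.
Proof.
move=> IK finK neq; have finI := finitary_sub IK finK.
rewrite ltnNge; apply/negP => le; apply: neq; apply/seteqP; split=> // s Ks.
have wE : longest S I = longest S K.
  apply: longest_eq => //; apply: (parabolic_sub IK).
  exact: longest_parabolic.
apply: longest_desc => //; first by case: finK => KS _; exact: KS.
by rewrite wE; exact: longest_ldesc.
Qed.

Lemma ell_longest_quo I K : I `<=` K -> finitary S K ->
  (l ((longest S I)^-1 * longest S K) + ellI S I)%N = ellI S K.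
Proof.
move=> IK finK; apply: longest_mul => //.
apply: (parabolic_sub IK); apply: longest_parabolic.
exact: finitary_sub finK.
Qed.

(** * Core double cosets *)

Lemma dcoset_mem I J x a b : parabolic I a -> parabolic J b ->
  dcoset I J x (a * x * b).
Proof. by move=> Ia Jb; exists a => //; exists b. Qed.

Lemma dcoset_refl I J x : dcoset I J x x.
Proof.
by have := dcoset_mem x (@parabolic1 I) (@parabolic1 J); rewrite mul1g mulg1.
Qed.

Lemma dcoset_eq I J x y : dcoset I J x y -> dcoset I J y = dcoset I J x.
Proof.
move=> [a Ia [b Jb <-]]; apply/seteqP; split=> _ [c Ic [d Jd <-]].
  have -> : c * (a * x * b) * d = (c * a) * x * (b * d) by rewrite !mulgA.
  by apply: dcoset_mem; exact: parabolicM.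
have -> : c * x * d = (c * a^-1) * (a * x * b) * (b^-1 * d).
  by rewrite !mulgA mulgKV mulgK.
by apply: dcoset_mem; apply: parabolicM => //; exact: parabolicV.
Qed.

Lemma bruhat_ell x y : bruhat S x y -> x = y \/ (l x < l y)%N.
Proof.
elim=> {x y} [x|x t y _ lt _ [<-|lt']]; [by left|by right|right].
exact: ltn_trans lt'.
Qed.

Lemma bruhat_gen_mul s x : S s -> (l x < l (s * x))%N -> bruhat S x (s * x).
Proof.
move=> Ss; have -> : s * x = x * (x^-1 * s * x).
  by rewrite !mulgA mulgV mul1g.
move=> lt; apply: (bruhat_step _ lt); last exact: bruhat_refl.
by exists x^-1, s; rewrite invgK.
Qed.

Lemma cmin_coset I J p : I `<=` S -> is_coset I J p ->
  lmin I (cmin S p) /\ p = dcoset I J (cmin S p).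
Proof.
move=> IS [x0 ->]; set p0 := dcoset _ _ _.
suff [p0min bmin] : p0 (cmin S p0) /\
    forall y, p0 y -> bruhat S y (cmin S p0) -> y = cmin S p0.
  split; last by rewrite (dcoset_eq p0min).
  move=> s Is; have Ss := IS _ Is; rewrite ltnNge; apply/negP => le.
  have lt : (l (s * cmin S p0) < l (cmin S p0))%N.
    by have := ell_gen_mul (cmin S p0) Ss; lia.
  have /bmin : p0 (s * cmin S p0).
    have := dcoset_mem (cmin S p0) (parabolic_gen Is) (@parabolic1 J).
    by rewrite mulg1 (dcoset_eq p0min).
  have b : bruhat S (s * cmin S p0) (cmin S p0).
    by have := @bruhat_gen_mul s (s * cmin S p0) Ss; rewrite mulKgen//; apply.
  by move=> /(_ b) e; rewrite e ltnn in lt.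
(* An element of least length is Bruhat-minimal, so [xget] does not return its default. *)
rewrite /cmin; set P := (X in xget _ X); apply: (@xgetPex _ _ P).
have ex : exists n, `[< exists2 x, p0 x & l x = n >].
  by exists (l x0); apply/asboolP; exists x0 => //; exact: dcoset_refl.
case: (ex_minnP ex) => n /asboolP[x px xn] nmin; exists x; split=> // y py.
case/bruhat_ell => // lt; have : (n <= l y)%N.
  by apply: nmin; apply/asboolP; exists y.
lia.
Qed.

(** A core coset described through its minimal element; [core_cosetE] and [core_coset_core]
    translate between the two forms. *)
Definition core I J x :=
  [/\ finitary S I, lmin I x & I = [set x * j * x^-1 | j in J]].

Section Core.
Variables (I J : set W) (x : W).
Hypothesis cor : core I J x.

Notation p := (dcoset I J x).

Let finI : finitary S I. Proof. by case: cor. Qed.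
Let IS : I `<=` S. Proof. by case: finI. Qed.
Let xmin : lmin I x. Proof. by case: cor. Qed.

Lemma core_conj j : J j -> I (x * j * x^-1).
Proof. by case: cor => _ _ IE Jj; rewrite IE; exists j. Qed.

Lemma core_conjV i : I i -> exists2 j, J j & x * j = i * x.
Proof.
case: cor => _ _ IE; rewrite {1}IE => -[j Jj <-].
by exists j => //; rewrite mulgKV.
Qed.

(** Conjugation by x carries W_J into W_I, so the right factor moves to the left of x. *)
Lemma core_mem y : p y -> exists2 a, parabolic I a & y = a * x.
Proof.
move=> [a Ia [b Jb <-]]; exists (a * (x * b * x^-1)); last first.
  by rewrite !mulgA mulgKV.
apply: parabolicM => //.
apply: (@smallest_sub _ _ _ [set b | parabolic I (x * b * x^-1)]) Jb => /=.
  split=> /= [|c d Ic Id]; first by rewrite mulg1 mulgV; exact: parabolic1.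
  have -> : x * (c * d^-1) * x^-1 = (x * c * x^-1) * (x * d * x^-1)^-1.
    by rewrite !invMg invgK !mulgA mulgKV.
  by apply: parabolicM => //; exact: parabolicV.
by move=> j /core_conj /parabolic_gen.
Qed.

Lemma core_mul_mem a : parabolic I a -> p (a * x).
Proof.
by move=> Ia; have := dcoset_mem x Ia (@parabolic1 J); rewrite mulg1.
Qed.

Lemma ell_core a : parabolic I a -> l (a * x) = (l a + l x)%N.
Proof. exact: ell_lmin_mul. Qed.

Lemma cmin_core : cmin S p = x.
Proof.
apply: xget_unique => [|y [/core_mem[a Ia ->] amin]].
  split=> [|y /core_mem[a Ia ->]]; first exact: dcoset_refl.
  by case/bruhat_ell => //; rewrite ell_core//; lia.
have [->|/eqP a1] := eqVneq a 1; first by rewrite mul1g.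
have [s Is e] := parabolic_lt IS Ia a1; have Ss := IS Is.
have Isa : parabolic I (s * a) by apply: parabolicM => //; exact: parabolic_gen.
have lt : (l (s * a * x) < l (a * x))%N by rewrite !ell_core//; lia.
have b : bruhat S (s * a * x) (a * x).
  have := @bruhat_gen_mul s (s * a * x) Ss.
  by rewrite -mulgA mulKgen// mulgA; apply.
by rewrite (amin _ (core_mul_mem Isa) b) ltnn in lt.
Qed.

Lemma cmax_core : cmax S p = longest S I * x.
Proof.
have Iw := longest_parabolic finI.
apply: xget_unique => [|y [/core_mem[a Ia ->] amax]].
  split=> [|y /core_mem[a Ia ->]]; first exact: core_mul_mem.
  case/bruhat_ell => //; rewrite !ell_core//.
  by have := longest_max finI Ia; lia.
congr (_ * x); apply: ldesc_longest => // s Is; have Ss := IS Is.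
rewrite ltnNge; apply/negP => le.
have Isa : parabolic I (s * a) by apply: parabolicM => //; exact: parabolic_gen.
have lt : (l (a * x) < l (s * (a * x)))%N.
  by rewrite mulgA !ell_core//; have := ell_gen_mul a Ss; lia.
have := amax (s * (a * x)); rewrite mulgA => /(_ (core_mul_mem Isa)).
rewrite -mulgA => /(_ (bruhat_gen_mul Ss lt)) e.
by rewrite e ltnn in lt.
Qed.

(* [x] conjugates [J] to [I], so right descents of [a x] in [J] are right      *)
(* descents of [a] in [I].                                                     *)
Lemma core_rdesc_longest a : parabolic I a -> rdesc J (a * x) ->
  a = longest S I.
Proof.
move=> Ia ax; rewrite -longestV// -(ldesc_longest finI (parabolicV Ia)).
  by rewrite invgK.
move=> i Ii; have [j Jj e] := core_conjV Ii; have := ax j Jj.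
have Pai : parabolic I (a * i) by apply: parabolicM => //; exact: parabolic_gen.
rewrite -mulgA e mulgA !ell_core// ltn_add2r -(ellV a) -(ellV (a * i)) invMg.
by rewrite (genV (IS Ii)).
Qed.

Lemma core_coset_core : core_coset S I J p.
Proof. by split; [exists x|rewrite cmin_core; case: cor]. Qed.

End Core.

Lemma core_cosetE I J r : finitary S I -> core_coset S I J r ->
  core I J (cmin S r) /\ r = dcoset I J (cmin S r).
Proof.
move=> finI [cr IE]; have [IS _] := finI.
by have [rmin rE] := cmin_coset IS cr.
Qed.

Lemma ell_conj_le I J x a : I `<=` S -> J `<=` S ->
  (forall i, I i -> J (x^-1 * i * x)) -> parabolic I a ->
  (l (x^-1 * a * x) <= l a)%N.
Proof.
move=> IS JS IJ; move: a; apply: (parabolic_ind IS) => [|s a Is _ -> le].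
  by rewrite mulg1 mulVg ell1.
have -> : x^-1 * (s * a) * x = (x^-1 * s * x) * (x^-1 * a * x).
  by rewrite !mulgA mulgK.
by rewrite (leq_trans (ellM _ _))// -add1n leq_add// ell_gen//; exact/JS/IJ.
Qed.

(** For v in W_I, l (v^-1 x) = l x - l v; here v = w_I s is one shorter than w_I. *)
Lemma lmin_longest_mul I x : finitary S I -> ldesc I x ->
  lmin I (longest S I * x).
Proof.
move=> finI xI s Is; have [IS _] := finI; set w := longest S I.
have Iw : parabolic I w by exact: longest_parabolic.
have Iws : parabolic I (w * s) by apply: parabolicM => //; exact: parabolic_gen.
have := ldesc_mul IS xI Iws; have := ldesc_mul IS xI Iw.
rewrite invMg !longestV// (genV (IS _ Is)) -mulgA.
have := longest_ldesc finI Is; rewrite -/w -(ellV (s * w)) invMg.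
by rewrite longestV// -/w (genV (IS _ Is)); lia.
Qed.

(** * The star product *)

Lemma reduced_word_spec x : [/\ word S (reduced_word S x),
  wprod (reduced_word S x) = x & size (reduced_word S x) = l x].
Proof.
rewrite /reduced_word; set P := (X in xget _ X).
exact: (@xgetPex _ _ P (reduced_ex x)).
Qed.

Lemma reduced_cons s u : S s -> word S u -> size (s :: u) = l (s * wprod u) ->
  size u = l (wprod u) /\ l (s * wprod u) = (l (wprod u)).+1.
Proof.
move=> Ss Su /=; have := ell_wprod Su; have := ell_gen_mul (wprod u) Ss; lia.
Qed.

(** When a letter s does not lengthen the current value, the exchange moves it out of b: the value
    is unchanged, but it now starts with s. *)
Lemma star_factor x y :
  exists2 b, star S x y = x * b & l (x * b) = (l x + l b)%N.
Proof.
rewrite /star; have [] := reduced_word_spec x.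
set u := reduced_word S x; move: u => u Su <- {x}; elim: u Su => [|s u IHu].
  by exists y; rewrite /= wprod_nil ?mul1g ?ell1.
move=> /word_cons[Ss Su]; rewrite wprod_cons => /(reduced_cons Ss Su)[su lsu].
have [b /= -> lb] := IHu Su su; rewrite /star_simple.
have [lt|le] := ltnP; first exists b; rewrite -?mulgA//.
  by move: lt; have := ell_gen_mul (wprod u * b) Ss; lia.
have [|b' e eb] := exchange_mul Ss lb _ le; first by rewrite lsu.
have ub : wprod u * b = s * wprod u * b' by rewrite -mulgA -e mulKgen.
by exists b'; rewrite -?ub//; lia.
Qed.

Lemma star_parabolic K x y : K `<=` S -> parabolic K x ->
  exists2 c, parabolic K c & star S x y = c * y.
Proof.
move=> KS Kx; rewrite /star; have [] := reduced_word_spec x.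
set u := reduced_word S x; move: u => u Su uE; rewrite -uE in Kx * => {uE x}.
elim: u Su Kx => [|s u IHu].
  by exists 1; rewrite ?mul1g//; exact: parabolic1.
move=> /word_cons[Ss Su]; rewrite wprod_cons => Ksu.
move=> /(reduced_cons Ss Su)[su lsu].
have Ks : K s by apply: (parabolic_desc KS Ss Ksu); rewrite mulKgen// lsu.
have Ku : parabolic K (wprod u).
  rewrite -(mulKgen (wprod u) Ss); apply: parabolicM => //.
  exact: parabolic_gen.
have [c Kc /= ->] := IHu Su Ku su; rewrite /star_simple.
have [_|_] := ltnP; last by exists c.
exists (s * c); last by rewrite mulgA.
by apply: parabolicM => //; exact: parabolic_gen.
Qed.

(** The result has the form c a x with c in W_K, and also starts with w_K without loss of length;
    hence c a is at least as long as w_K. *)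
Lemma star_longest K a x : finitary S K -> lmin K x -> parabolic K a ->
  star S (longest S K) (a * x) = longest S K * x.
Proof.
move=> finK xmin Ka; have [KS _] := finK; set w := longest S K.
have Kw : parabolic K w by exact: longest_parabolic.
have [b gE lb] := star_factor w (a * x).
have [c Kc] := star_parabolic (a * x) KS Kw; rewrite gE mulgA => e.
have Kca : parabolic K (c * a) by exact: parabolicM.
rewrite e; congr (_ * x); apply: longest_eq => //; rewrite -/w.
have bE : b = (w * (c * a)) * x by rewrite -mulgA -e longestK.
have := longest_mul finK Kca; rewrite -/w.
have <- : l (w * (c * a)) = l ((c * a)^-1 * w).
  by rewrite -ellV invMg longestV.
move: lb; rewrite e bE !(ell_lmin_mul KS xmin)//; first lia.
exact: parabolicM.
Qed.

(** * Expressions *)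

(** [gprod] and [glen] treat the last pair separately; nonemptiness of the tail gives the uniform
    recursions below. *)
Lemma group_neq0 A L : group_up A L <> [::] :> seq (set W * set W).
Proof.
suff: forall K A, group_up A L <> [::] :> seq (set W * set W) /\
  group_down K A L <> [::] by move=> /(_ A A)[].
by elim: L => [|B L IHL] K A' //=; case: ifP => _; split; try by [];
  case: (IHL K B) => // h1 h2; case: (IHL A' B).
Qed.

Lemma gprod_cons K C B L : gprod S ((K, C) :: group_up B L) =
  longest S K * (longest S C)^-1 * gprod S (group_up B L).
Proof. by have := @group_neq0 B L; case: (group_up B L). Qed.

Lemma glen_cons K C B L : glen S ((K, C) :: group_up B L) =
  ((ellI S K)%:Z - (ellI S C)%:Z + glen S (group_up B L))%R.
Proof. by have := @group_neq0 B L; case: (group_up B L). Qed.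

Lemma expression_head I J L : expression S I J L -> exists L', L = I :: L'.
Proof. by case=> [? _|? ? ? L' *]; [exists [::]|exists L']. Qed.

Lemma expression_fin I J L : expression S I J L -> finitary S I.
Proof. by case. Qed.

Lemma expression1 I J : expression S I J [:: I] -> J = I.
Proof.
move=> e; inversion e as [|? ? ? ? ? ? e']; first by [].
by have [] := expression_head e'.
Qed.

Lemma expression_cons2 I J B L : expression S I J [:: I, B & L] ->
  add_or_remove S I B /\ expression S B J (B :: L).
Proof.
move=> e; inversion e as [|? L1 ? ? ? st e']; subst.
by have [L' [BE _]] := expression_head e'; subst.
Qed.

Lemma add_or_removeP A B : add_or_remove S A B ->
  [/\ A `<=` B & A <> B] \/ ~ A `<=` B /\ B `<=` A.
Proof.
move=> [s [_ [[As ->]|[As ->]]]]; [left; split|right; split].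
- by move=> x Ax; left.
- by move=> e; apply: As; rewrite e; right.
- by move=> /(_ s As)[_]; apply.
- by move=> x [].
Qed.

Lemma group_up_add A B L : A `<=` B ->
  group_up A (B :: L) = group_up B L :> seq (set W * set W).
Proof. by move=> AB /=; case: asboolP. Qed.

Lemma group_up_remove A B L : ~ A `<=` B ->
  group_up A (B :: L) = group_down A B L :> seq (set W * set W).
Proof. by move=> AB /=; case: asboolP. Qed.

Lemma group_down_split K A J L : expression S A J (A :: L) ->
  [/\ group_down K A L = [:: (K, J)], J `<=` A & J = A -> L = [::]] \/
  exists C B L', [/\ group_down K A L = (K, C) :: group_up B L',
    C `<=` A, C `<=` B /\ C <> B, expression S B J (B :: L') &
    (size L' < size L)%N].
Proof.
elim: L A => [|B L IHL] A; first by move=> /expression1 ->; left; split.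
move=> /expression_cons2[/add_or_removeP[AB e|[nAB BA] e]]; [right|].
  have [AsB neAB] := AB; exists A, B, L; split=> //=.
  by case: asboolP.
have -> : group_down K A (B :: L) = group_down K B L.
  by move=> /=; case: asboolP.
case: (IHL B e) => [[-> JB _]|[C [B' [L' [-> CB CB' e' sL]]]]]; [left|right].
  split=> //; first exact: subset_trans BA.
  by move=> JA; case: nAB; rewrite -JA.
exists C, B', L'; split=> //; first exact: subset_trans BA.
by rewrite /= ltnW.
Qed.

Lemma group_up_split A J L : expression S A J (A :: L) ->
  exists K, [/\ A `<=` K, finitary S K &
    (group_up A L = [:: (K, J)] /\ J `<=` K) \/
    exists C B L', [/\ group_up A L = (K, C) :: group_up B L',
      C `<=` K, C `<=` B /\ C <> B, expression S B J (B :: L') &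
      (size L' < size L)%N]].
Proof.
elim: L A => [|B L IHL] A e; have finA := expression_fin e.
  by have -> := expression1 e; exists A; split=> //; left; split.
have [/add_or_removeP[[AB _]|[nAB BA]] eB] := expression_cons2 e.
  have [K [BK finK H]] := IHL B eB.
  exists K; split=> //; first exact: subset_trans BK.
  rewrite group_up_add//; case: H => [|[C [B' [L' [-> CK CB e' sL]]]]].
    by left.
  by right; exists C, B', L'; split=> //; rewrite /= ltnW.
exists A; split=> //; rewrite group_up_remove//.
case: (@group_down_split A B J L eB) => [[-> JB _]|].
  by left; split=> //; exact: subset_trans BA.
move=> [C [B' [L' [-> CB CB' e' sL]]]]; right.
by exists C, B', L'; split=> //=; [exact: subset_trans BA|rewrite ltnW].
Qed.

(** Each w_C^-1 w_K with C inside K has length l(K) - l(C), so [glen] bounds the length of the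
    product, even with its first or last longest element split off. *)
Lemma group_up_factors A J L : expression S A J (A :: L) ->
  (exists K h (n : nat), [/\ A `<=` K /\ finitary S K,
    gprod S (group_up A L) = longest S K * h,
    glen S (group_up A L) = (ellI S K + n)%N%:Z%R & (l h <= n)%N]) /\
  (exists K h (n : nat), [/\ J `<=` K /\ finitary S K,
    gprod S (group_up A L) = h * longest S K,
    glen S (group_up A L) = (n + ellI S K)%N%:Z%R & (l h <= n)%N]).
Proof.
elim: {L}(size L) {-2}L (leqnn (size L)) A => [|k IHk] L sL A e;
  have [K [AK finK [[-> JK]|]]] := group_up_split e.
- by split; exists K, 1, 0%N; rewrite ?addn0 ?mulg1 ?mul1g ?ell1.
- by move=> [C [B [L' [_ _ _ _]]]]; rewrite ltnNge (leq_trans sL).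
- by split; exists K, 1, 0%N; rewrite ?addn0 ?mulg1 ?mul1g ?ell1.
move=> [C [B [L' [-> CK [CB _] eB sL']]]].
have sL'k : (size L' <= k)%N by rewrite -ltnS (leq_trans sL').
have [[K2 [h [n [[BK2 finK2] gE lE hn]]]]] := IHk L' sL'k B eB.
move=> [K3 [h3 [n3 [[JK3 finK3] gE3 lE3 hn3]]]].
have CK2 := subset_trans CB BK2; have finC := finitary_sub CK finK.
have lK := ell_longest_quo CK finK; have lK2 := ell_longest_quo CK2 finK2.
rewrite gprod_cons glen_cons; split.
  exists K, ((longest S C)^-1 * longest S K2 * h).
  exists (ellI S K2 - ellI S C + n)%N; split=> //.
  - by rewrite gE !mulgA.
  - by rewrite lE; lia.
  - by apply: leq_trans (ellM _ _) _; lia.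
exists K3, (longest S K * (longest S C)^-1 * h3).
exists (ellI S K - ellI S C + n3)%N; split=> //.
- by rewrite gE3 !mulgA.
- by rewrite lE3; lia.
apply: leq_trans (ellM _ _) _.
have : l (longest S K * (longest S C)^-1) = l ((longest S C)^-1 * longest S K).
  by rewrite -ellV invMg invgK !longestV.
lia.
Qed.

Lemma glen_ge A J L : expression S A J (A :: L) ->
  ((ellI S A)%:Z <= glen S (group_up A L))%R.
Proof.
move=> /group_up_factors[[K [h [n [[AK finK] _ -> _]]]] _].
by have := ellI_le AK finK; lia.
Qed.

(** Equality in the bound of [group_up_factors] means that a shorter first or last factor shortens
    the whole product. *)
Lemma reduced_desc A J L : expression S A J (A :: L) ->
  (l (gprod S (group_up A L)))%:Z%R = glen S (group_up A L) ->
  ldesc A (gprod S (group_up A L)) /\ rdesc J (gprod S (group_up A L)).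
Proof.
move=> e; have [[K [h [n [[AK finK] gE lE hn]]]] _] := group_up_factors e.
have [_ [K' [h' [n' [[JK' finK'] gE' lE' hn']]]]] := group_up_factors e.
move=> red; split=> s Hs.
  move: red; rewrite gE lE mulgA => red.
  apply: leq_ltn_trans (ellM _ _) _.
  by have := longest_ldesc finK (AK _ Hs); move: red; rewrite /ellI; lia.
move: red; rewrite gE' lE' -mulgA => red.
apply: leq_ltn_trans (ellM _ _) _.
have := longest_ldesc finK' (JK' _ Hs).
rewrite -(ellV (s * _)) invMg longestV//.
have [K'S _] := finK'.
by rewrite (genV (K'S _ (JK' _ Hs))); move: red; rewrite /ellI; lia.
Qed.

(** * Uniqueness of reduced expressions *)

Lemma ldesc_longest_sub K A : finitary S K -> A `<=` S ->
  ldesc A (longest S K) -> A `<=` K.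
Proof.
by move=> finK AS h s As; apply: longest_desc => //; [exact: AS|exact: h].
Qed.

(* After a first removal, the remaining expression evaluates to [w_C x] with   *)
(* [C] a proper subset of [I], but [J] forces it to be [w_I x].                *)
Lemma core_no_remove I J x B L : core I J x ->
  expression S I J [:: I, B & L] -> ~ I `<=` B ->
  cmax S (dcoset I J x) = gprod S (grouping [:: I, B & L]) ->
  (l (cmax S (dcoset I J x)))%:Z%R <> glen S (grouping [:: I, B & L]).
Proof.
move=> cor e nIB; have finI := expression_fin e; have [IS _] := finI.
have [/add_or_removeP[[]//|[_ BI]] eB] := expression_cons2 e.
rewrite (cmax_core cor) [grouping _]group_up_remove//.
case: (@group_down_split I B J L eB) => [[-> JB _]|].
  rewrite /= => wx _; have x1 : x = 1.
    by apply: (@mulgI _ (longest S I)); rewrite mulg1.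
  apply: nIB => i Ii; apply: JB; have [j Jj] := core_conjV cor Ii.
  by rewrite x1 mul1g mulg1 => <-.
move=> [C [B' [L' [-> CB [CB' _] eB' _]]]]; rewrite gprod_cons glen_cons.
set g := gprod S _; have CI := subset_trans CB BI.
have finC := finitary_sub CI finI.
rewrite -mulgA => /(@mulgI _ (longest S I)) xE.
have gE : g = longest S C * x by rewrite xE mulVKg.
have IC : parabolic I (longest S C).
  by apply: (parabolic_sub CI); exact: longest_parabolic.
rewrite (ell_core cor (longest_parabolic finI)) -/(ellI S I) => lE.
have lg : l g = (ellI S C + l x)%N by rewrite gE (ell_core cor).
(* By [lE] the rest of the expression is itself reduced, so J consists of right descents of [g]. *)
have [|_ gJ] := reduced_desc eB'; first by rewrite -/g lg; lia.
have wE := core_rdesc_longest cor IC; rewrite -gE in wE.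
have := ellI_lt CI finI; rewrite /ellI wE// ltnn => h.
suff: C <> I by move/h.
by move=> CeI; apply: nIB; rewrite -CeI.
Qed.

Lemma cmax_core1 I J : core I J 1 -> cmax S (dcoset I J 1) = longest S I.
Proof. by move=> cor; rewrite cmax_core// mulg1. Qed.

(** A first addition would give w_I a left descent outside I. *)
Lemma core1_unique I : core I I 1 ->
  unique_reduced_expression S I I (dcoset I I 1) [:: I].
Proof.
move=> cor; have [finI _ _] := cor; split.
  by split; [exact: expression_nil|exact: cmax_core1|rewrite cmax_core1].
move=> L [e]; have [[|B L'] LE] := expression_head e; subst L => // gE lE.
exfalso; have [/add_or_removeP[[IB neq]|[nIB _]] eB] := expression_cons2 e.
  have [BS _] := expression_fin eB.
  move: lE; rewrite gE [grouping _]group_up_add// => /(reduced_desc eB)[h _].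
  apply: neq; apply/seteqP; split=> //; apply: ldesc_longest_sub => //.
  by rewrite -(cmax_core1 cor) gE [grouping _]group_up_add.
exact: core_no_remove cor e nIB gE lE.
Qed.

(** The equation for y makes w_K the maximal element, so K bounds the initial additions, and the
    length leaves room only for removals after them. *)
Lemma core_add_unique I s t y : let K := I `|` [set s] in
  finitary S K -> ~ I s -> K t -> core I (K `\ t) y ->
  longest S I * y = longest S K ->
  unique_reduced_expression S I (K `\ t) (dcoset I (K `\ t) y)
    [:: I; K; K `\ t].
Proof.
move=> K finK nIs Kt cor yE; have [finI _ _] := cor.
have [KS _] := finK; set M := K `\ t in cor *.
have IK : I `<=` K by move=> x; left.
have neIK : I <> K by move=> e; apply: nIs; rewrite e; right.
have MK : M `<=` K by move=> x [].
have nKM : ~ K `<=` M by move=> /(_ t Kt)[_]; apply.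
have finM := finitary_sub MK finK.
have cE : cmax S (dcoset I M y) = longest S K by rewrite cmax_core.
have grE : grouping [:: I; K; M] = [:: (K, M)].
  by rewrite [grouping _]group_up_add// group_up_remove.
split; first split.
- apply: expression_cons => //.
    by exists s; split; [apply: KS; right|left].
  apply: expression_cons => //; last exact: expression_nil.
  by exists t; split; [exact: KS|right].
- by rewrite grE.
- by rewrite grE cE.
move=> L [e]; have [L1 LE] := expression_head e; subst L.
case: L1 e => [e gE _|B L2 e gE lE].
  have := ellI_lt IK finK neIK.
  by rewrite /ellI -cE gE /= ltnn.
have [st eB] := expression_cons2 e; have [BS _] := expression_fin eB.
have [[IB neIB]|[nIB _]] := add_or_removeP st; last first.
  by have := core_no_remove cor e nIB gE lE.
move: gE lE; rewrite [grouping _]group_up_add// cE => gE lE.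
have BK : B `<=` K.
  apply: ldesc_longest_sub => //; rewrite gE.
  by case: (reduced_desc eB); rewrite -?gE.
have {}BK : B = K.
  apply/seteqP; split=> // x [/IB//|->].
  case: st => s' [_ [[nIs' BE]|[_ BE]]]; last first.
    by case: neIB; apply/seteqP; split=> // z; rewrite BE => -[].
  have : B s' by rewrite BE; right.
  by move=> Bs'; case: (BK _ Bs') => // <-.
subst B; case: L2 e eB gE lE => [|B L3] e eB gE lE.
  by have KM := expression1 eB; case: nKM; rewrite KM.
have [st' eB'] := expression_cons2 eB; have [BS' _] := expression_fin eB'.
have [[KB neKB]|[nKB BK]] := add_or_removeP st'.
  case: neKB; apply/seteqP; split=> //; apply: ldesc_longest_sub => //.
  move: lE; rewrite gE group_up_add// => /(reduced_desc eB')[h _].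
  exact: h.
move: gE lE; rewrite group_up_remove//.
case: (@group_down_split K B M L3 eB') => [[_ MB L3E] _ _|].
  (* Both sets are K without one element, and M is contained in B. *)
  have BM : M = B.
    case: st' => t1 [_ [[nKt1 BE]|[Kt1 BE]]].
      by case: nKB; rewrite BE => x; left.
    apply/seteqP; split=> // x; rewrite BE => -[Kx xt1]; split=> // xt.
    have : M t1 by split=> // t1t; apply: xt1; rewrite xt t1t.
    by move=> /MB; rewrite BE => -[_]; apply.
  by rewrite (L3E BM) BM.
(* A later addition from C to B' makes the length at least l(K) - l(C) + l(B') > l(K). *)
move=> [C [B' [L' [-> _ [CB' neCB'] eB'' _]]]] _; rewrite glen_cons.
have := glen_ge eB''; have := ellI_lt CB' (expression_fin eB'') neCB'.
by rewrite -/(ellI S K); lia.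
Qed.

(** * Splitting off a factor *)

(* A left descent [s] of [x], together with [I], descends the maximal element  *)
(* [w_I x] of the coset, since [w_I x = x b] with [b] no longer than [w_I].    *)
Lemma core_ldesc_add I J x s : finitary S J -> core I J x -> S s ->
  (l (s * x) < l x)%N -> ldesc (I `|` [set s]) (longest S I * x).
Proof.
move=> [JS _] cor Ss sx i; have [finI xmin IE] := cor; have [IS _] := finI.
have Iw := longest_parabolic finI.
case=> [Ii|->].
  have Iiw : parabolic I (i * longest S I).
    by apply: parabolicM => //; exact: parabolic_gen.
  rewrite mulgA !(ell_core cor)// ltn_add2r; exact: longest_ldesc.
have JI i' : I i' -> J (x^-1 * i' * x).
  move=> /(core_conjV cor)[j Jj e].
  by rewrite -mulgA -e mulKg.
have := ell_conj_le IS JS JI Iw.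
have e : longest S I * x = x * (x^-1 * longest S I * x).
  by rewrite !mulgA mulgV mul1g.
rewrite (ell_core cor Iw) e mulgA.
by have := ellM (s * x) (x^-1 * longest S I * x); lia.
Qed.

(** Conjugation by w_K permutes K and sends t to s, hence K - t onto I; conjugation by w_I then
    permutes I. *)
Lemma core_longest_quo I s : let K := I `|` [set s] in finitary S K -> ~ I s ->
  core I (K `\ (longest S K * s * longest S K)) (longest S I * longest S K).
Proof.
move=> K finK nIs; have IK : I `<=` K by move=> x; left.
have finI := finitary_sub IK finK; set t := _ * _ * _.
have sE : longest S K * t * longest S K = s.
  by rewrite /t !mulgA longest_sq// mul1g -mulgA longest_sq// mulg1.
have conjK x : longest S K * (longest S K * x * longest S K) * longest S K = x.
  by rewrite -!mulgA longest_sq// mulg1 longestK.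
split=> //.
  apply: lmin_longest_mul => // i Ii; apply: longest_ldesc => //; exact: IK.
have yconj m : longest S I * longest S K * m * (longest S I * longest S K)^-1 =
    longest S I * (longest S K * m * longest S K) * longest S I.
  by rewrite invMg !longestV// !mulgA.
apply/seteqP; split=> [i Ii|_ [m [Km mt] <-]].
  have Ii' := longest_conj finI Ii.
  exists (longest S K * (longest S I * i * longest S I) * longest S K).
    split; first by apply: longest_conj => //; exact: IK.
    move=> /(congr1 (fun x => longest S K * x * longest S K)).
    by rewrite conjK sE => e; apply: nIs; rewrite -e.
  by rewrite yconj conjK -!mulgA longest_sq// mulg1 longestK.
rewrite yconj; apply: longest_conj => //.
case: (longest_conj finK Km) => // ms; case: mt.
by rewrite -[m]conjK ms.
Qed.

Lemma core_quo I M J y z : finitary S M -> lmin M z -> core I M y ->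
  core I J (y * z) -> core M J z.
Proof.
move=> finM zmin cy cyz; split=> //; apply/seteqP; split=> [m Mm|_ [j Jj <-]].
  have [j Jj e] := core_conjV cyz (core_conj cy Mm); exists j => //.
  apply: (@mulIg _ z); rewrite mulgKV; apply: (@mulgI _ y).
  by rewrite mulgA e !mulgA mulgKV.
have [m Mm e] := core_conjV cy (core_conj cyz Jj).
suff -> : z * j * z^-1 = m by [].
apply: (@mulgI _ y); rewrite e invMg.
by rewrite !mulgA mulgKV.
Qed.

(** The maximal elements are w_K and w_M z; the star product with w_K absorbs w_M and gives w_K z =
    w_I y z. *)
Lemma core_composition I M J K y z : finitary S K -> M `<=` K -> lmin K z ->
  core I M y -> core M J z -> core I J (y * z) ->
  longest S I * y = longest S K ->
  reduced_composition S M (dcoset I M y) (dcoset M J z) /\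
  dcoset I J (y * z) = composition S I J (dcoset I M y) (dcoset M J z).
Proof.
move=> finK MK zmin cy cz cyz yE; have [KS _] := finK.
have finM := finitary_sub MK finK; have [finI _ _] := cy.
have KwM : parabolic K (longest S M).
  by apply: (parabolic_sub MK); exact: longest_parabolic.
have Kw := longest_parabolic finK.
rewrite /reduced_composition /composition !cmax_core// yE star_longest//.
split; first split.
- by rewrite longestV// -mulgA longestK.
- rewrite (ell_lmin_mul KS zmin Kw) (ell_core cz (longest_parabolic finM)).
  by rewrite /ellI; lia.
rewrite -yE -mulgA; apply/esym; apply: dcoset_eq.
exact: (core_mul_mem J (y * z) (longest_parabolic finI)).
Qed.

End Coxeter.

Theorem theorem2p16 (W : groupType) (S I J r : set W)
  (cox : coxeter_system S)
  (finI : finitary S I) (finJ : finitary S J)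
  (core_r : core_coset S I J r) :
  (identity_coset S I J r /\ unique_reduced_expression S I J r [:: I])
  \/
  (exists (s : W) (p q : set W),
     let Is := I `|` [set s] in
     let t := longest S Is * s * longest S Is in
     let M := Is `\ t in
     [/\ S s, ~ I s & finitary S Is] /\
     [/\ core_coset S I M p,
         core_coset S M J q,
         reduced_composition S M p q,
         r = composition S I J p q &
         unique_reduced_expression S I M p [:: I; Is; M]]).
Proof.
have [cx rE] := core_cosetE cox finI core_r; move: cx rE core_r.
move: (cmin S r) => x cx -> {r} core_r; have [IS _] := finI.
have [x1|/eqP x1] := eqVneq x 1; [left|right].
  subst x; have IJ : I = J.
    case: core_r => _; rewrite (cmin_core cox cx) => ->.
    apply/seteqP; split=> [_ [j Jj <-]|j Jj].
      by rewrite mul1g invg1 mulg1.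
    by exists j => //; rewrite mul1g invg1 mulg1.
  subst J; split; first by split=> //; exact: cmin_core.
  exact: core1_unique.
(* All of W is the parabolic subgroup of S, so x has a left descent. *)
have [s Ss sx] : exists2 s, S s & ell S x = (ell S (s * x)%g).+1.
  apply: (@parabolic_lt _ _ cox S) => //.
  by have [u [Su <- _]] := reduced_ex cox x; exact: parabolic_word.
have nIs : ~ I s.
  by case: cx => _ xmin _ Is; have := xmin s Is; rewrite sx ltnNge leqnSn.
have KS : I `|` [set s] `<=` S by move=> i [/IS|->].
have ux : ldesc S (I `|` [set s]) (longest S I * x).
  by apply: (core_ldesc_add cox finJ cx Ss); rewrite sx.
have finK : finitary S (I `|` [set s]).
  apply: ldesc_finitary ux => //; rewrite finite_setU.
  split; last exact: finite_set1.
  by case: finI => _; apply: sub_finite_set; exact: sub_gen_smallest.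
set K := I `|` [set s] in KS ux finK.
pose t := longest S K * s * longest S K; pose M := K `\ t.
pose y := longest S I * longest S K.
pose z := longest S K * (longest S I * x).
have Kt : K t by apply: longest_conj => //; right.
have MK : M `<=` K by move=> i [].
have finM := finitary_sub MK finK.
have xE : x = y * z by rewrite /y /z -mulgA !longestK.
have yE : longest S I * y = longest S K by rewrite /y longestK.
have zmin : lmin S K z by exact: lmin_longest_mul.
have cy : core S I M y by exact: core_longest_quo.
have zminM : lmin S M z by move=> i /MK; exact: zmin.
rewrite xE in cx core_r *.
have cz : core S M J z by exact: core_quo cx.
have [red comp] := core_composition cox finK MK zmin cy cz cx yE.
exists s, (dcoset I M y), (dcoset M J z); split; first by split.
split=> //.
- exact: core_coset_core.
- exact: core_coset_core.
- exact: core_add_unique.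
Qed.
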